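(* Let $U\subseteq R^m(-\mathbf d)$ be a quasi-stable module, and let $M_0$ be the $m\times|\mathcal P_U|$ matrix whose columns are the elements of the marked set $\mathcal F$ and $M_1$ the $|\mathcal P_U|\times|\mathcal P_{U^{(1)}}|$ matrix whose columns are the elements of the set $\mathcal F_{\mathrm{pre-syz}}$ of fundamental pre-syzygies, where the parameters in $C$ and $B$ take values in a Noetherian $\mathbb K$-algebra $A$. Then $\mathcal F$ is a $U$-marked basis and $\mathcal F_{\mathrm{pre-syz}}$ is the corresponding set of fundamental syzygies if and only if $M_0M_1=0$.
   Context: $\mathbb K$ is a field, $R=\mathbb K[x_0,\dots,x_n]$ with the standard grading and $x_0<\dots<x_n$; $R_A=R\otimes_{\mathbb K}A$. A term of $R$ is a monomial $x^\alpha$; for $x^\alpha\neq1$, $\min(x^\alpha)$, $\max(x^\alpha)$ are the smallest and largest variable dividing it. Variables $x_i>\min(x^\alpha)$ are non-multiplicative for $x^\alpha$ (the term $1$ has none). $R_A^m(-\mathbf d)=\bigoplus_k R_A(-d_k)\mathbf e_k$, with terms $x^\alpha\mathbf e_k$ of degree $|\alpha|+d_k$. For a monomial submodule $U$ (generated by terms), $\mathcal N(U)$ is the set of terms not in $U$. Pommaret cone: $\mathcal C(x^\alpha)=\{x^\delta x^\alpha\mid\delta_i=0\ \forall x_i>\min(x^\alpha)\}$ for $x^\alpha\neq 1$, $\mathcal C(1)=$ all terms, $\mathcal C(x^\alpha\mathbf e_k)=\mathcal C(x^\alpha)\mathbf e_k$. A Pommaret basis of $U$ is a set of terms generating $U$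 whose cones partition the set of terms of $U$; it is unique if it exists, denoted $\mathcal P_U$. $U$ is quasi-stable if it has a finite Pommaret basis, stable if moreover $\mathcal P_U$ is its minimal monomial generating set. A $U$-marked set is a finite set $\{f_{\alpha,k}\}_{x^\alpha\mathbf e_k\in\mathcal P_U}\subset R_A^m(-\mathbf d)$ of homogeneous elements such that $x^\alpha\mathbf e_k$ has coefficient $1$ in $f_{\alpha,k}$ and the support of $f_{\alpha,k}-x^\alpha\mathbf e_k$ is in $\mathcal N(U)$; it is a $U$-marked basis if $(R_A^m(-\mathbf d))_s=(F)_s\oplus\langle\mathcal N(U)_s\rangle_A$ for all $s$. For a $U$-marked basis each $f\in(F)$ has a unique writing $f=\sum P_{\gamma,\ell}f_{\gamma,\ell}$ with all terms of $P_{\gamma,\ell}x^\gamma$ in $\mathcal C(x^\gamma)$; for $x_i>\min(x^\alpha)$ the fundamental syzygy is $x_i\mathbf f_{\alpha,k}-\sum P_{\gamma,\ell}\mathbf f_{\gamma,\ell}$, obtained from the unique writing $x_if_{\alpha,k}=\sum P_{\gamma,\ell}f_{\gamma,\ell}$. Parametrized sets. $C=\{C_{\alpha,k}^{\beta,\ell}\mid x^\alpha\mathbf e_k\in\mathcal P_U,\ x^\beta\mathbf e_\ell\in\mathcal N(U),\ \deg x^\beta\mathbf e_\ell=\deg x^\alpha\mathbf e_k\}$; $\mathcal F=\{F_{\alpha,k}\}$ with $F_{\alpha,k}=x^\alpha\mathbf e_k-\sum C_{\alpha,k}^{\beta,\ell}x^\beta\mathbf e_\ell$. Let $\mathbf f_{\alpha,k}$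 be free basis elements of degree $\deg x^\alpha\mathbf e_k$ indexed by $\mathcal P_U$, and $U^{(1)}$ the stable module with Pommaret basis $\{x_i\mathbf f_{\alpha,k}\mid x_i>\min(x^\alpha)\}$. For $x_i>\min(x^\alpha)$ let $\mathsf s_{i,\alpha,k}$ be the set of terms $x^\eta\mathbf f_{\gamma,\ell}\in\mathcal N(U^{(1)})$ with $x^\gamma\mathbf e_\ell\in\mathcal P_U$, $\max(x^\eta)\le\min\{x_{i-1},\min(x^\gamma)\}$ ($x^\eta=1$ allowed; if $x^\gamma=1$ only $\max(x^\eta)\le x_{i-1}$ is required) and $\deg x^\eta\mathbf f_{\gamma,\ell}=\deg x^\alpha\mathbf e_k+1$. The parameters in $B$ are $B_{i,\alpha,k}^{\eta,\gamma,\ell}$ for $x^\eta\mathbf f_{\gamma,\ell}\in\mathsf s_{i,\alpha,k}$, and the fundamental pre-syzygies forming $\mathcal F_{\mathrm{pre-syz}}$ are $x_i\mathbf f_{\alpha,k}-\sum_{x^\eta\mathbf f_{\gamma,\ell}\in\mathsf s_{i,\alpha,k}}B_{i,\alpha,k}^{\eta,\gamma,\ell}x^\eta\mathbf f_{\gamma,\ell}$, for $x^\alpha\mathbf e_k\in\mathcal P_U$, $x_i>\min(x^\alpha)$. *)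

(* Defs.v *)
From HB Require Import structures.
From mathcomp Require Import all_boot all_order all_algebra.
From mathcomp Require Import boolp.
From mathcomp Require Export mpoly.

Set Implicit Arguments.
Unset Strict Implicit.
Unset Printing Implicit Defensive.

Import Order.TTheory GRing.Theory.
Local Open Scope ring_scope.

(** The ring R is [{mpoly K[n.+1]}], with variables x_0 < ... < x_n; the free
    module R^m is the type of column vectors ['cV[{mpoly K[n.+1]}]_m].  The
    grading shift d enters only through [tdeg] and [homogeneous]. *)

(* Linear combinations for an explicit scalar action, so that the same notion
   covers R_A-submodules, A-submodules of R_A^m, and ideals of A. *)
Definition span (S : nzRingType) (V : zmodType) (act : S -> V -> V)
    (G : V -> Prop) (v : V) : Prop :=
  exists2 r : seq (S * V),
    (forall x, x \in r -> G x.2) & v = \sum_(x <- r) act x.1 x.2.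

Definition submodule_gen (S : nzRingType) (V : lmodType S) (G : V -> Prop) :
    V -> Prop :=
  span *:%R G.

Definition noetherian (A : comNzRingType) : Prop :=
  forall I : {pred A^o}, submod_closed I ->
    exists s : seq A^o, forall a : A^o,
      a \in I <-> submodule_gen (fun x : A^o => x \in s) a.

Section Terms.
Context {n : nat}.

(* Empty case: min(1) is n.+1, beyond every variable index, so that 1 has no
   non-multiplicative variable and its Pommaret cone contains all terms. *)
Definition minvar (a : 'X_{1..n.+1}) : nat :=
  \big[minn/n.+1]_(i < n.+1 | a i != 0%N) i.

(* Empty case: max(1) is 0, so that max(1) <= j always holds. *)
Definition maxvar (a : 'X_{1..n.+1}) : nat :=
  \max_(i < n.+1 | a i != 0%N) i.

Definition nonmult (a : 'X_{1..n.+1}) (i : 'I_n.+1) : bool := (minvar a < i)%N.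

(* The pair (a, k) stands for x^a e_k. *)
Definition term (m : nat) : Type := ('X_{1..n.+1} * 'I_m)%type.

Definition tvec (S : nzRingType) (m : nat) (t : term m) :
    'cV[{mpoly S[n.+1]}]_m :=
  'X_[t.1] *: delta_mx t.2 0.

Definition tcoeff (S : nzRingType) (m : nat) (v : 'cV[{mpoly S[n.+1]}]_m)
    (t : term m) : S :=
  (v t.2 0)@_(t.1).

Definition tdeg (m : nat) (d : 'I_m -> int) (t : term m) : int :=
  (mdeg t.1)%:Z + d t.2.

Definition homogeneous (S : nzRingType) (m : nat) (d : 'I_m -> int) (s : int)
    (v : 'cV[{mpoly S[n.+1]}]_m) : Prop :=
  forall t, tcoeff v t != 0 -> tdeg d t = s.

(* Since d k is fixed, the exponents occurring in component k have total degree
   at most |s - d k|, whence the bound on the enumerated monomials. *)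
Definition terms_of_deg (m : nat) (d : 'I_m -> int) (s : int) : seq (term m) :=
  [seq t <- [seq (bmnm b, k) | k <- enum 'I_m,
                 b <- enum {: 'X_{1..n.+1 < `|s - d k|%N.+1}}]
     | tdeg d t == s].

Lemma mem_terms_of_deg (m : nat) (d : 'I_m -> int) (s : int) (t : term m) :
  (t \in terms_of_deg d s) = (tdeg d t == s).
Proof.
rewrite mem_filter; case: eqP => //= ts; case: t ts => a k ts.
have hb : (mdeg a < `|s - d k|%N.+1)%N.
  by rewrite -ts /tdeg /= addrK absz_nat ltnS.
apply/allpairsPdep; exists k, (BMultinom hb).
by split; rewrite ?mem_enum.
Qed.

Lemma terms_of_deg_uniq (m : nat) (d : 'I_m -> int) (s : int) :
  uniq (terms_of_deg d s).
Proof.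
apply: filter_uniq; apply: allpairs_uniq_dep.
- exact: enum_uniq.
- by move=> k _; exact: enum_uniq.
move=> [k b] [k' b'] _ _ /= [] + kk'; subst k' => /val_inj bb'.
by rewrite bb'.
Qed.

Definition cone (m : nat) (p t : term m) : Prop :=
  exists2 delta : 'X_{1..n.+1},
    (forall i, nonmult p.1 i -> delta i = 0%N) & t = ((delta + p.1)%MM, p.2).

Section Submodules.
Context (K : fieldType) {m : nat}.
Implicit Types (U : 'cV[{mpoly K[n.+1]}]_m -> Prop) (Q : term m -> Prop).

Definition term_gen Q : 'cV[{mpoly K[n.+1]}]_m -> Prop :=
  submodule_gen (fun v => exists2 t, Q t & v = tvec K t).

Definition monomial_submodule U : Prop :=
  exists Q, forall v, U v <-> term_gen Q v.

Definition normal_term U (t : term m) : Prop := ~ U (tvec K t).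

Definition pommaret_basis U Q : Prop :=
  [/\ forall v, U v <-> term_gen Q v,
      forall t, U (tvec K t) <-> exists2 p, Q p & cone p t
    & forall p q t, Q p -> Q q -> cone p t -> cone q t -> p = q].

Definition quasi_stable U : Prop :=
  monomial_submodule U /\ exists P : seq (term m), pommaret_basis U (fun t => t \in P).

End Submodules.

(** [P] is an enumeration of the Pommaret basis of U; families indexed by it
    are indexed by positions in [P]. *)
Section Marked.
Context (K : fieldType) {m : nat} (d : 'I_m -> int).
Context (U : 'cV[{mpoly K[n.+1]}]_m -> Prop) (P : seq (term m)).
Context (A : comAlgType K).

Notation RA := {mpoly A[n.+1]}.
Notation pterm j := (tnth (in_tuple P) j).

Definition family_submodule (F : 'I_(size P) -> 'cV[RA]_m) : 'cV[RA]_m -> Prop :=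
  submodule_gen (fun v => exists j, v = F j).

Definition normal_span (s : int) : 'cV[RA]_m -> Prop :=
  span (fun (c : A) (v : 'cV[RA]_m) => c%:MP *: v)
    (fun v => exists2 t, normal_term U t /\ tdeg d t = s & v = tvec A t).

Definition marked_set (F : 'I_(size P) -> 'cV[RA]_m) : Prop :=
  forall j, [/\ exists s, homogeneous d s (F j),
                tcoeff (F j) (pterm j) = 1
              & forall t, tcoeff (F j - tvec A (pterm j)) t != 0 ->
                  normal_term U t].

Definition marked_basis (F : 'I_(size P) -> 'cV[RA]_m) : Prop :=
  marked_set F /\
  forall s : int,
    (forall v, homogeneous d s v ->
       exists f g, [/\ family_submodule F f, homogeneous d s f, normal_span s g
                     & v = f + g]) /\
    (forall v, family_submodule F v -> homogeneous d s v -> normal_span s v -> v = 0).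

(* For a marked basis, the cofactors q are unique. *)
Definition fundamental_syzygy (F : 'I_(size P) -> 'cV[RA]_m)
    (i : 'I_n.+1) (j : 'I_(size P)) (z : 'cV[RA]_(size P)) : Prop :=
  exists q : 'cV[RA]_(size P),
    [/\ forall l eta, eta \in msupp (q l 0) ->
          cone (pterm l) ((eta + (pterm l).1)%MM, (pterm l).2),
        'X_i *: F j = \sum_l q l 0 *: F l
      & z = 'X_i *: delta_mx j 0 - q].

(* Only the values C j t with t in N(U), of the degree of the j-th term of P,
   are used. *)
Definition param_marked (C : 'I_(size P) -> term m -> A) (j : 'I_(size P)) :
    'cV[RA]_m :=
  tvec A (pterm j)
  - \sum_(t <- terms_of_deg d (tdeg d (pterm j)) | `[< normal_term U t >])
      (C j t)%:MP *: tvec A t.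

Definition nonmult_pairs : seq ('I_n.+1 * 'I_(size P)) :=
  [seq p <- enum {: 'I_n.+1 * 'I_(size P)} | nonmult (pterm p.2).1 p.1].

(* The module U^(1), in the free module on the basis indexed by P. *)
Definition syz_module : 'cV[{mpoly K[n.+1]}]_(size P) -> Prop :=
  term_gen (fun t : term (size P) =>
    exists2 p, p \in nonmult_pairs & t = (U_(p.1)%MM, p.2)).

Definition syz_shift (j : 'I_(size P)) : int := tdeg d (pterm j).

Definition presyz_terms (i : 'I_n.+1) (j : 'I_(size P)) : seq (term (size P)) :=
  [seq t <- terms_of_deg syz_shift (tdeg d (pterm j) + 1)
     | `[< normal_term syz_module t >]
       && (maxvar t.1 <= minn i.-1 (minvar (pterm t.2).1))%N].

(* Only the values B i j t with t in presyz_terms i j are used. *)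
Definition presyz (B : 'I_n.+1 -> 'I_(size P) -> term (size P) -> A)
    (i : 'I_n.+1) (j : 'I_(size P)) : 'cV[RA]_(size P) :=
  'X_i *: delta_mx j 0
  - \sum_(t <- presyz_terms i j) (B i j t)%:MP *: tvec A t.

Definition M0 (C : 'I_(size P) -> term m -> A) : 'M[RA]_(m, size P) :=
  \matrix_(k, j) param_marked C j k 0.

Definition M1 (B : 'I_n.+1 -> 'I_(size P) -> term (size P) -> A) :
    'M[RA]_(size P, size nonmult_pairs) :=
  \matrix_(l, c) presyz B (tnth (in_tuple nonmult_pairs) c).1
                          (tnth (in_tuple nonmult_pairs) c).2 l 0.

End Marked.
End Terms.

Arguments term n m : clear implicits.

Lemma tcoeff_scale_tvec (S : nzRingType) n m (c : {mpoly S[n.+1]}) (q t : term n m) :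
  tcoeff (c *: tvec S q) t != 0 -> exists delta, t = ((delta + q.1)%MM, q.2).
Proof.
case: q t => [a k] [b l]; rewrite /tcoeff /tvec !mxE /= eqxx andbT.
have [->|lk] := eqVneq l k; last by rewrite !mulr0 mcoeff0 eqxx.
rewrite mulr1 -mcoeff_msupp (perm_mem (msuppMX _ _)).
by case/mapP=> e _ ->; exists e; rewrite addmC.
Qed.

Lemma term_gen_tvec (K : fieldType) n m (Q : term n m -> Prop) (t : term n m) :
  term_gen Q (tvec K t) -> exists2 q, Q q & exists delta, t = ((delta + q.1)%MM, q.2).
Proof.
case=> r rQ tE.
have : tcoeff (tvec K t) t != 0.
  by rewrite /tcoeff /tvec !mxE !eqxx mulr1 mcoeffX eqxx oner_neq0.
rewrite {1}tE /tcoeff summxE raddf_sum /=.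
elim: r rQ {tE} => [|x r IH] rQ; first by rewrite big_nil eqxx.
rewrite big_cons.
have [-> |h _] := eqVneq (((x.1 *: x.2) t.2 0)@_t.1) 0.
  by rewrite add0r; apply: IH => y yr; apply: rQ; rewrite inE yr orbT.
have [q Qq xq] := rQ x (mem_head _ _).
by exists q => //; move: h; rewrite xq; apply: tcoeff_scale_tvec.
Qed.

Lemma gen_tvec (K : fieldType) n m (Q : term n m -> Prop) q (delta : 'X_{1..n.+1}):
  Q q -> term_gen Q (tvec K ((delta + q.1)%MM, q.2)).
Proof.
move=> Qq; exists [:: ('X_[delta], tvec K q)].
  by move=> x; rewrite inE => /eqP ->; exists q.
by rewrite big_seq1 /tvec /= scalerA mpolyXD.
Qed.

Lemma minvar_le n (a : 'X_{1..n.+1}) (i : 'I_n.+1) : a i != 0%N -> (minvar a <= i)%N.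
Proof.
move=> ai; rewrite /minvar; have := mem_index_enum i.
elim: index_enum => // k r IH; rewrite inE big_cons => /orP [/eqP <-|/IH le].
  by rewrite ai geq_minl.
by case: ifP => // _; rewrite geq_min le orbT.
Qed.

Lemma le_minvar n (a : 'X_{1..n.+1}) k : (k <= n.+1)%N ->
  (forall i : 'I_n.+1, a i != 0%N -> (k <= i)%N) -> (k <= minvar a)%N.
Proof.
move=> kn H; rewrite /minvar; elim/big_rec: _ => // i x ai kx.
by rewrite leq_min H.
Qed.

Lemma minvarU n (i : 'I_n.+1) : minvar U_(i)%MM = i.
Proof.
apply/eqP; rewrite eqn_leq minvar_le ?mnm1E ?eqxx //=.
apply: le_minvar (ltnW (ltn_ord i)) _.
by move=> j; rewrite mnm1E; case: (eqVneq i j) => [->|].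
Qed.

(* The terms indexing the columns of M1 form the Pommaret basis of U^(1). *)
Lemma syz_module_basis (K : fieldType) n m (P : seq (term n m)) :
  pommaret_basis (syz_module (K := K) (P := P))
   (fun t : term n (size P) =>
    exists2 p, p \in nonmult_pairs P & t = (U_(p.1)%MM, p.2)).
Proof.
split => //.
- move=> t; split; last first.
    by move=> [p Qp [delta _ ->]]; apply: gen_tvec.
  case/term_gen_tvec => _ [[i j] pQ ->] [delta ->] /=.
  have [l lP lmax] : {l : 'I_n.+1 | (delta + U_(i))%MM l != 0%N
      & forall k, (delta + U_(i))%MM k != 0%N -> (k <= l)%N}.
    have h : (delta + U_(i))%MM i != 0%N by rewrite mnmDE mnm1E eqxx addn1.
    case: (@arg_maxnP _ i (fun k => (delta + U_(i))%MM k != 0%N) (@nat_of_ord n.+1) h).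
    by move=> l ? ?; exists l.
  exists (U_(l)%MM, j).
    exists (l, j) => //; move: pQ; rewrite mem_filter => /andP [h _].
    rewrite mem_filter; apply/andP; split; last by rewrite mem_enum.
    rewrite /nonmult /= in h *; apply: leq_trans h _.
    by apply: lmax; rewrite mnmDE mnm1E eqxx addn1.
  exists ((delta + U_(i)) - U_(l))%MM.
    move=> k; rewrite /nonmult /= minvarU => lk.
    have k0 : (delta + U_(i))%MM k = 0%N.
      by apply/eqP; apply: contraTT lk => /lmax; rewrite -leqNgt.
    by rewrite mnmBE k0.
  congr pair; rewrite submK //; apply/mnm_lepP => k.
  by rewrite mnm1E; case: eqP => // <-; rewrite lt0n.
- move=> _ _ t [[i j] _ ->] [[i' j'] _ ->] [e /= he ->] [e' /= he' E].
  have /= jj := congr1 snd E; rewrite -jj; congr pair.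
  have ee k : (e + U_(i))%MM k = (e' + U_(i'))%MM k := congr1 (fun t : 'X_{1..n.+1} * 'I_(size P) => t.1 k) E.
  congr mnm1.
  rewrite /nonmult !minvarU in he he'.
  apply/val_inj/eqP; rewrite eqn_leq /=; apply/andP; split; rewrite leqNgt; apply/negP => lt.
    by have := ee i; rewrite !mnmDE !mnm1E eqxx (he' _ lt) addn1 -val_eqE /= ltn_eqF.
  by have := ee i'; rewrite !mnmDE !mnm1E eqxx (he _ lt) addn1 -val_eqE /= ltn_eqF.
Qed.

(* Main.v *)
Require Import Defs.
From HB Require Import structures.
From mathcomp Require Import all_boot all_order all_algebra.
From mathcomp Require Import boolp.

Import GRing.Theory.
Local Open Scope ring_scope.


(** Write F_j for the columns of M_0, p_j for the head term of F_j, and call a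
    combination of the F_j standard if every term of the coefficient of F_j,
    multiplied by p_j, stays in the Pommaret cone of p_j.  The columns of M_1 are
    indexed by the pairs (i, j) with x_i non-multiplicative for p_j, and M_0 M_1 = 0
    says that each x_i F_j equals the combination prescribed by the parameters
    in B ([M0M1_eq0]).  By the choice of the terms in the pre-syzygies this
    combination is standard, hence the fundamental syzygy of (i, j), and its
    coefficients involve only variables smaller than x_i.  The direct implication
    and the statement about syzygies follow at once; what remains is to deduce
    from these relations that F is a marked basis.

    The engine is a decrease ([cone_weight]): if x^b is not in U but x^e x^b lies
    in the cone of x^a, say x^e x^b = x^d x^a, then d precedes e
    lexicographically, comparing the exponents of the largest variable first.
    So replacing a head term by the tail of its marked polynomial lowers the
    multiplier.

    - Every homogeneous element is a sum of an element of (F) and one of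
      <N(U)> ([decomposes_homogeneous]): rewrite terms of U by marked
      polynomials; the decrease makes this terminate, already for any marked set.
    - A standard combination with support in N(U) is zero
      ([standard_normal_eq0]): the head of a summand with maximal multiplier can
      cancel neither against another head, since cones are disjoint, nor against
      a tail term, by the decrease.
    - Under the relations above, standard combinations are closed under
      multiplication by x_i, by strong induction on i ([standardX]): a
      non-multiplicative product x_i F_j is replaced by a combination in which
      only smaller variables multiply the F_l.  Hence every element of (F) is
      standard, and the sum of (F) and <N(U)> is direct. *)

(** * Lexicographic decrease of multipliers *)

Section Weight.
Set Implicit Arguments.
Unset Strict Implicit.

Lemma digits_lt (N n : nat) (f : 'I_n -> nat) :
  (forall k, f k < N)%N -> (\sum_(k < n) f k * N ^ k < N ^ n)%N.
Proof.
elim: n f => [|n IH] f fN; first by rewrite big_ord0 expn0.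
rewrite big_ord_recr /= expnS.
apply: (@leq_trans (N ^ n + f ord_max * N ^ n)%N).
  by rewrite ltn_add2r; apply: IH.
by rewrite -mulSn leq_mul2r fN orbT.
Qed.

Lemma digits_lex (N n : nat) (f g : 'I_n -> nat) (i : 'I_n) :
    (forall k, f k < N)%N -> (f i < g i)%N ->
    (forall k : 'I_n, (i < k)%N -> f k = g k) ->
  (\sum_(k < n) f k * N ^ k < \sum_(k < n) g k * N ^ k)%N.
Proof.
elim: n f g i => [|n IH] f g i fN fgi fgk; first by case: i {fgi fgk}.
rewrite !big_ord_recr /=.
have [iE|im] := eqVneq i ord_max.
  apply: (@leq_trans (N ^ n + f ord_max * N ^ n)%N).
    by rewrite ltn_add2r; apply: digits_lt.
  by rewrite -mulSn (leq_trans _ (leq_addl _ _)) // leq_mul2r -iE fgi orbT.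
have lt_in : (i < n)%N.
  by rewrite ltn_neqAle -ltnS ltn_ord andbT; apply: contra_neq im => ?; apply: val_inj.
rewrite (fgk ord_max) // ltn_add2r.
pose i' := Ordinal lt_in.
have i'E : widen_ord (leqnSn n) i' = i by apply: val_inj.
by apply: (IH _ _ i') => [k||k ik]; rewrite ?i'E //; apply: fgk.
Qed.

(** Exponent vectors with entries below N, read as numbers in base N, are ordered
    lexicographically with the largest variable most significant.  A numerical
    weight makes this order available both for induction and for maxima. *)
Definition weight (n N : nat) (a : 'X_{1..n.+1}) : nat :=
  \sum_(i < n.+1) a i * N ^ i.

(** At the largest variable x_i where delta and eta differ, delta_i > eta_i is
    impossible: x_i would occur in x^delta, so p would involve no variable below
    x_i, and comparing exponents from x_i upwards p would divide b, which is not
    in U.  If delta = eta then p = b, which is excluded in the same way. *)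
Lemma cone_weight (K : fieldType) (n m N : nat)
    (U : 'cV[{mpoly K[n.+1]}]_m -> Prop) (P : seq (term n m))
    (p b : term n m) (delta eta : 'X_{1..n.+1}) :
    pommaret_basis U (fun t => t \in P) -> p \in P ->
    cone p ((delta + p.1)%MM, p.2) -> normal_term U b ->
    ((eta + b.1)%MM, b.2) = ((delta + p.1)%MM, p.2) ->
    (forall k, delta k < N)%N ->
  (weight N delta < weight N eta)%N.
Proof.
move=> [Ugen _ _] pP [delta' dmult dE] nb bE dN.
have /= {}dE := mpoly.addIm (congr1 fst dE); subst delta'.
have /= bE1 := congr1 fst bE; have /= bE2 := congr1 snd bE.
have ndvd : ~ (p.1 <= b.1)%MM.
  move=> le; apply: nb; apply/Ugen.
  have := @gen_tvec K n m (fun t => t \in P) p (b.1 - p.1)%MM pP.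
  by rewrite submK // -bE2 -surjective_pairing.
have coord k : (eta k + b.1 k = delta k + p.1 k)%N.
  by rewrite -!mnmDE bE1.
have [i0 ne0] : exists i, delta i != eta i.
  apply/existsP; apply: contra_notT ndvd; rewrite negb_exists => /forallP same.
  apply/mnm_lepP => k; have := coord k; have := same k.
  by rewrite negbK => /eqP -> /addnI ->.
have [i ne imax] : exists2 i : 'I_n.+1, delta i != eta i
    & forall k, delta k != eta k -> (k <= i)%N.
  have := @arg_maxnP _ i0 (fun i => delta i != eta i) (@nat_of_ord n.+1) ne0.
  by case=> i; exists i.
have above (k : 'I_n.+1) : (i < k)%N -> delta k = eta k.
  by move=> ik; apply/eqP; apply: contraTT ik => /imax; rewrite -leqNgt.
apply: (@digits_lex _ _ delta eta i) => //.
rewrite ltn_neqAle ne leqNgt; apply/negP => lt.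
apply: ndvd; apply/mnm_lepP => k.
have [ki|ik|/ord_inj ->] := ltngtP k i.
- have -> // : p.1 k = 0%N.
  apply/eqP; apply: contraTT ki => /minvar_le le; rewrite -leqNgt.
  apply: leq_trans le; rewrite leqNgt; apply/negP => /dmult d0.
  by rewrite d0 in lt.
- by have := coord k; rewrite above // => /addnI ->.
- by rewrite -(leq_add2l (delta i)) -coord leq_add2r ltnW.
Qed.

End Weight.

(** * Coefficients and expansion into terms *)

Section Coefficients.
Set Implicit Arguments.
Unset Strict Implicit.
Context {n : nat} (A : comNzRingType).
Notation RA := {mpoly A[n.+1]}.

Lemma tcoeffD m (v w : 'cV[RA]_m) t : tcoeff (v + w) t = tcoeff v t + tcoeff w t.
Proof. by rewrite /tcoeff mxE mcoeffD. Qed.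

Lemma tcoeffB m (v w : 'cV[RA]_m) t : tcoeff (v - w) t = tcoeff v t - tcoeff w t.
Proof. by rewrite /tcoeff !mxE mcoeffB. Qed.

Lemma tcoeff0 m (t : term n m) : tcoeff (0 : 'cV[RA]_m) t = 0.
Proof. by rewrite /tcoeff mxE mcoeff0. Qed.

Lemma tcoeff_sum m (I : Type) (r : seq I) (p : pred I) (v : I -> 'cV[RA]_m) t :
  tcoeff (\sum_(i <- r | p i) v i) t = \sum_(i <- r | p i) tcoeff (v i) t.
Proof.
apply: (big_morph (fun v => tcoeff v t)) => [v1 v2|]; last exact: tcoeff0.
exact: tcoeffD.
Qed.

Lemma tcoeffCZ m (c : A) (v : 'cV[RA]_m) t : tcoeff (c%:MP *: v) t = c * tcoeff v t.
Proof. by rewrite /tcoeff mxE mcoeffCM. Qed.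

Lemma tcoeff_tvec m (u t : term n m) : tcoeff (tvec A u) t = (u == t)%:R.
Proof.
case: u t => [a k] [b l]; rewrite /tcoeff /tvec !mxE /= eqxx andbT xpair_eqE.
by rewrite mulr_natr mcoeffMn mcoeffX -mulrnA mulnb eq_sym [k == l]eq_sym.
Qed.

Lemma tcoeff_scaleX m (e : 'X_{1..n.+1}) (v : 'cV[RA]_m) (t : term n m) :
  tcoeff ('X_[e] *: v) ((e + t.1)%MM, t.2) = tcoeff v t.
Proof. by rewrite /tcoeff mxE /= mulrC mcoeffMX. Qed.

Lemma tcoeff_scaleX_neq0 m (e : 'X_{1..n.+1}) (v : 'cV[RA]_m) (t : term n m) :
  tcoeff ('X_[e] *: v) t != 0 ->
  exists2 b, tcoeff v b != 0 & t = ((e + b.1)%MM, b.2).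
Proof.
case: t => [c k] ne.
have : c \in msupp (v k 0 * 'X_[e]).
  by move: ne; rewrite /tcoeff mxE mulrC -mcoeff_msupp.
rewrite (perm_mem (msuppMX _ _)) => /mapP [b bv ->].
by exists (b, k) => //; rewrite /tcoeff -mcoeff_msupp.
Qed.

Lemma scale_mpoly_expand (V : lmodType RA) (p : RA) (v : V) :
  p *: v = \sum_(a <- msupp p) (p@_a)%:MP *: ('X_[a] *: v).
Proof.
rewrite {1}[p]mpolyE scaler_suml; apply: eq_bigr => a _.
by rewrite -mul_mpolyC scalerA.
Qed.

Lemma term_expand m (v : 'cV[RA]_m) :
  v = \sum_k \sum_(a <- msupp (v k 0)) (tcoeff v (a, k))%:MP *: tvec A (a, k).
Proof.
rewrite {1}[v]matrix_sum_delta; apply: eq_bigr => k _.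
by rewrite big_ord1 scale_mpoly_expand.
Qed.

Lemma span_add (S : nzRingType) (V : zmodType) (act : S -> V -> V) G v w :
  Defs.span act G v -> Defs.span act G w -> Defs.span act G (v + w).
Proof.
move=> [r rG ->] [r' rG' ->]; exists (r ++ r'); last by rewrite big_cat.
by move=> x; rewrite mem_cat => /orP [/rG|/rG'].
Qed.

Lemma span_scale (S : nzRingType) (V : zmodType) (act : S -> V -> V)
    (G : V -> Prop) (f : V -> V) (c : S) v :
    {morph f : x y / x + y} -> f 0 = 0 -> (forall a x, f (act a x) = act (c * a) x) ->
  Defs.span act G v -> Defs.span act G (f v).
Proof.
move=> fD f0 fact [r rG ->]; exists [seq (c * x.1, x.2) | x <- r].
  by move=> y /mapP [x xr ->]; apply: (rG x).
by rewrite (big_morph f fD f0) big_map; apply: eq_bigr => x _.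
Qed.

End Coefficients.

(** * Standard combinations *)

Section Standard.
Set Implicit Arguments.
Unset Strict Implicit.
Context (K : fieldType) {n m : nat} (d : 'I_m -> int).
Context (U : 'cV[{mpoly K[n.+1]}]_m -> Prop) (P : seq (term n m)).
Context (A : comAlgType K).
Notation RA := {mpoly A[n.+1]}.
Notation pterm j := (tnth (in_tuple P) j).
Context (F : 'I_(size P) -> 'cV[RA]_m).

Lemma coneDE (p : term n m) (e : 'X_{1..n.+1}) :
  cone p ((e + p.1)%MM, p.2) <-> (forall i, nonmult p.1 i -> e i = 0%N).
Proof.
split=> [[e' h E]|h]; last by exists e.
by have /= -> := mpoly.addIm (congr1 fst E).
Qed.

Definition cone_supported (q : 'cV[RA]_(size P)) : Prop :=
  forall l eta, eta \in msupp (q l 0) ->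
    cone (pterm l) ((eta + (pterm l).1)%MM, (pterm l).2).

Definition standard (v : 'cV[RA]_m) : Prop :=
  exists2 q, cone_supported q & v = \sum_l q l 0 *: F l.

Lemma standard0 : standard 0.
Proof.
exists 0; first by move=> l e; rewrite mxE msupp0.
by rewrite big1 // => l _; rewrite mxE scale0r.
Qed.

Lemma standardD v w : standard v -> standard w -> standard (v + w).
Proof.
move=> [q hq ->] [q' hq' ->]; exists (q + q').
  move=> l e; rewrite mxE => /msuppD_le; rewrite mem_cat => /orP [/hq|/hq'] //.
by rewrite -big_split; apply: eq_bigr => l _; rewrite mxE scalerDl.
Qed.

Lemma standard_sum (I : eqType) (r : seq I) (v : I -> 'cV[RA]_m) :
  (forall i, i \in r -> standard (v i)) -> standard (\sum_(i <- r) v i).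
Proof.
elim: r => [|i r IH] h; first by rewrite big_nil; apply: standard0.
rewrite big_cons; apply: standardD; first exact/h/mem_head.
by apply: IH => k kr; apply: h; rewrite inE kr orbT.
Qed.

Lemma standardCZ (c : A) v : standard v -> standard (c%:MP *: v).
Proof.
move=> [q hq ->]; exists (c%:MP *: q).
  by move=> l e; rewrite mxE mul_mpolyC => /msuppZ_le /hq.
by rewrite scaler_sumr; apply: eq_bigr => l _; rewrite mxE scalerA.
Qed.

Lemma standard_mono (e : 'X_{1..n.+1}) l :
  (forall i, nonmult (pterm l).1 i -> e i = 0%N) -> standard ('X_[e] *: F l).
Proof.
move=> he; exists ('X_[e] *: delta_mx l 0).
  move=> k eta; rewrite !mxE andbT; have [->|_] := eqVneq k l; last by rewrite mulr0 msupp0.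
  by rewrite mulr1 msuppX inE => /eqP ->; apply/coneDE.
rewrite (bigD1 l) //= !mxE !eqxx mulr1 big1 ?addr0 // => k /negbTE kl.
by rewrite !mxE kl mulr0 scale0r.
Qed.

Lemma standard_ind (Q : 'cV[RA]_m -> Prop) :
    Q 0 -> (forall v w, Q v -> Q w -> Q (v + w)) ->
    (forall c v, Q v -> Q (c%:MP *: v)) ->
    (forall (e : 'X_{1..n.+1}) l, (forall i, nonmult (pterm l).1 i -> e i = 0%N) -> Q ('X_[e] *: F l)) ->
  forall v, standard v -> Q v.
Proof.
move=> Q0 QD QZ QX _ [q hq ->]; elim/big_ind: _ => // l _.
rewrite scale_mpoly_expand big_seq; elim/big_ind: _ => // e /hq /coneDE he.
exact/QZ/QX.
Qed.

Lemma mul_closed (W : 'cV[RA]_m -> Prop) (e : 'X_{1..n.+1}) :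
    (forall k v, e k != 0%N -> W v -> W ('X_k *: v)) ->
  forall v, W v -> W ('X_[e] *: v).
Proof.
move=> h; rewrite mpolyXE_id; elim/big_ind: _ => [v|p q hp hq v|k _ v].
- by rewrite scale1r.
- by move=> Wv; rewrite -scalerA; apply/hp/hq.
have := h k ; elim: (e k) => [|c IH] hk Wv; first by rewrite expr0 scale1r.
rewrite exprS -scalerA; apply: (hk) => //.
case: c hk IH => [|c] hk IH; first by rewrite expr0 scale1r.
exact: IH.
Qed.

(** What is retained of the vanishing of M_0 M_1 to prove that (F) consists of
    standard combinations: each relation moves from x_i to smaller variables. *)
Definition lower_relations : Prop := forall i j, nonmult (pterm j).1 i ->
  exists2 q : 'cV[RA]_(size P), 'X_i *: F j = \sum_l q l 0 *: F l &
    forall l eta, eta \in msupp (q l 0) -> forall k, eta k != 0%N -> (k < i)%N.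

(** Let x^e F_j be a summand with x_i non-multiplicative for p_j.  All variables
    of x^e are at most min(p_j), hence below x_i, and so are those of the
    cofactors that express x_i F_j.  Thus x_i x^e F_j arises from the standard
    elements F_l by multiplications with variables below x_i, and the induction
    hypothesis applies. *)
Lemma standardX i v :
  lower_relations -> standard v -> standard ('X_i *: v).
Proof.
move=> lower.
have [w] := ubnP (i : nat); elim: w i v => // w IH i v iw.
have below (e : 'X_{1..n.+1}) : (forall k : 'I_n.+1, e k != 0%N -> (k < i)%N) ->
    forall v, standard v -> standard ('X_[e] *: v).
  move=> he; apply: mul_closed => k u /he ki; apply: IH.
  exact: leq_trans ki _.
move: v; apply: standard_ind => [|v v' h h'|c v h|e j he].
- by rewrite scaler0; apply: standard0.
- by rewrite scalerDr; apply: standardD.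
- by rewrite scalerA mulrC -scalerA; apply: standardCZ.
have [nm|mult] := boolP (nonmult (pterm j).1 i); last first.
  rewrite scalerA -mpolyXD; apply: standard_mono => k nk.
  rewrite mnmDE he // mnm1E; case: eqP => // ik.
  by rewrite ik nk in mult.
rewrite scalerA mulrC -scalerA; apply: (below).
  move=> k ek; rewrite ltnNge; apply: contra ek => ik.
  by apply/eqP/he; apply: leq_trans nm ik.
have [q -> hq] := lower i j nm.
apply: standard_sum => l _; rewrite scale_mpoly_expand.
apply: standard_sum => eta /hq heta; apply: standardCZ; apply: (below) => //.
rewrite -[F l]scale1r -mpolyX0; apply: standard_mono => k _.
by rewrite mnm0E.
Qed.

Lemma family_standard v :
  lower_relations -> family_submodule F v -> standard v.
Proof.
move=> lower [r rF ->]; apply: standard_sum => -[p x] /rF /= [j ->].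
rewrite scale_mpoly_expand; apply: standard_sum => e _; apply: standardCZ.
apply: mul_closed => [k u _|]; first exact: standardX.
rewrite -[F j]scale1r -mpolyX0; apply: standard_mono => k _.
by rewrite mnm0E.
Qed.

End Standard.

(** * Marked sets and the direct sum decomposition *)

Lemma seq_argmax (T : eqType) (f : T -> nat) (s : seq T) (x0 : T) :
  x0 \in s -> exists2 x, x \in s & forall y, y \in s -> (f y <= f x)%N.
Proof.
elim: s x0 => // a s IH x0 _.
case: s IH => [_|b s IH].
  by exists a => [|y]; rewrite inE // => /eqP ->.
have [x xs xmax] := IH b (mem_head _ _).
have [le|lt] := leqP (f a) (f x).
  exists x; first by rewrite inE xs orbT.
  by move=> y; rewrite inE => /orP [/eqP ->|/xmax].
exists a; first exact: mem_head.
move=> y; rewrite inE => /orP [/eqP ->|/xmax le] //.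
exact: leq_trans le (ltnW lt).
Qed.

Section Marked.
Set Implicit Arguments.
Unset Strict Implicit.
Context (K : fieldType) {n m : nat} (d : 'I_m -> int).
Context (U : 'cV[{mpoly K[n.+1]}]_m -> Prop) (P : seq (term n m)).
Context (A : comAlgType K).
Notation RA := {mpoly A[n.+1]}.
Notation pterm j := (tnth (in_tuple P) j).
Context (F : 'I_(size P) -> 'cV[RA]_m).

Lemma marked_degree j b :
  marked_set d U F -> tcoeff (F j) b != 0 -> tdeg d b = tdeg d (pterm j).
Proof.
move=> /(_ j) [[s hom] lead _] /hom ->.
by rewrite -(hom (pterm j)) // lead oner_neq0.
Qed.

Lemma marked_tail j b :
  marked_set d U F -> tcoeff (F j) b != 0 -> b != pterm j -> normal_term U b.
Proof.
move=> /(_ j) [_ _ tail] nz ne; apply: tail.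
by rewrite tcoeffB tcoeff_tvec [pterm j == b]eq_sym (negbTE ne) subr0.
Qed.

Lemma mdeg_le (a : 'X_{1..n.+1}) k : (a k <= mdeg a)%N.
Proof. by rewrite mdegE (bigD1 k) //= leq_addr. Qed.

(** Among all pairs (e, l) with x^e in the support of q_l, one with x^e of
    maximal weight contributes the term x^e p_l of U.  Its coefficient in the sum
    is that of x^e in q_l: an equal head x^e' p_l' is excluded by disjointness of
    cones, and a tail term hitting it would force e' to have larger weight. *)
Lemma standard_normal_eq0 (q : 'cV[RA]_(size P)) :
    uniq P -> pommaret_basis U (fun t => t \in P) -> marked_set d U F ->
    cone_supported q ->
    (forall t, tcoeff (\sum_l q l 0 *: F l) t != 0 -> normal_term U t) ->
  q = 0.
Proof.
move=> uniqP hP mF hq hn; have [_ hU disj] := hP.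
apply/colP => l0; rewrite mxE; apply/eqP; apply: contraT => ql0.
pose s := [seq (e, l) | l <- enum 'I_(size P), e <- msupp (q l 0)].
have memS e l : (e \in msupp (q l 0)) = ((e, l) \in s).
  apply/idP/allpairsPdep => [es|[l' [e' [_ es [-> ->]]]] //].
  by exists l, e; rewrite mem_enum.
have [e0 e0s] : exists e0, (e0, l0) \in s.
  case E: (msupp (q l0 0)) => [|e0 r].
    by move/eqP: E; rewrite msupp_eq0 (negbTE ql0).
  by exists e0; rewrite -memS E mem_head.
pose N := (\max_(x <- s) mdeg x.1).+1.
have [[e l] els emax] := seq_argmax (fun x => weight N x.1) e0s.
have ce := hq l e; rewrite memS in ce; have {}ce := ce els.
set t := ((e + (pterm l).1)%MM, (pterm l).2) in ce.
have tU : U (tvec K t) by apply/hU; exists (pterm l); rewrite ?mem_tnth.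
have other e' l' : (e', l') \in s -> (e', l') != (e, l) ->
    tcoeff ('X_[e'] *: F l') t = 0.
  move=> els' ne; apply/eqP; apply: contraT => /tcoeff_scaleX_neq0 [b bF tE].
  have [bE|bp] := eqVneq b (pterm l').
    have pE : pterm l' = pterm l.
      apply: (disj _ _ t); rewrite ?mem_tnth //.
      by rewrite tE bE; apply: hq; rewrite memS.
    have lE : l' = l by apply/(tuple_uniqP (in_tuple P)): pE.
    move: ne; rewrite lE xpair_eqE eqxx andbT.
    have := congr1 fst tE; rewrite bE lE /= => /esym/mpoly.addIm ->.
    by rewrite eqxx.
  have nb := marked_tail mF bF bp.
  have := emax _ els'; rewrite leqNgt => /negP []; rewrite /=.
  apply: (cone_weight hP (mem_tnth l (in_tuple P)) ce nb (esym tE)) => k.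
  rewrite ltnS (leq_trans (mdeg_le _ _)) //.
  exact: (@leq_bigmax_seq _ s xpredT (fun x => mdeg x.1) (e, l)).
have coef : tcoeff (\sum_l q l 0 *: F l) t = (q l 0)@_e.
  rewrite tcoeff_sum (bigD1 l) //= [X in _ + X]big1 => [|l' nl]; last first.
    rewrite scale_mpoly_expand tcoeff_sum big_seq big1 // => e' e's.
    by rewrite tcoeffCZ other ?mulr0 -?memS // xpair_eqE (negbTE nl) andbF.
  rewrite addr0 scale_mpoly_expand tcoeff_sum (bigD1_seq e) ?msupp_uniq //=; last first.
    by rewrite memS.
  rewrite big_seq_cond big1 => [|e' /andP [e's ne]]; last first.
    by rewrite tcoeffCZ other ?mulr0 -?memS // xpair_eqE (negbTE ne).
  rewrite addr0 tcoeffCZ tcoeff_scaleX.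
  by have [_ -> _] := mF l; rewrite mulr1.
have := hn t; rewrite coef -mcoeff_msupp memS => /(_ els) nt.
by case: (nt tU).
Qed.

Definition decomposes (s : int) (v : 'cV[RA]_m) : Prop :=
  exists f g, [/\ family_submodule F f, homogeneous d s f, normal_span d U s g
                & v = f + g].

Lemma family_scale (p : RA) v : family_submodule F v -> family_submodule F (p *: v).
Proof.
apply: span_scale; [exact: scalerDr|exact: scaler0|].
by move=> a x; rewrite scalerA.
Qed.

Lemma family_gen j : family_submodule F (F j).
Proof.
exists [:: (1, F j)]; last by rewrite big_seq1 scale1r.
by move=> x; rewrite inE => /eqP -> /=; exists j.
Qed.

Lemma decomposes0 s : decomposes s 0.
Proof.
exists 0, 0; split; last by rewrite addr0.
- by exists [::]; rewrite ?big_nil.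
- by move=> t; rewrite tcoeff0 eqxx.
- by exists [::]; rewrite ?big_nil.
Qed.

Lemma decomposesD s v w : decomposes s v -> decomposes s w -> decomposes s (v + w).
Proof.
move=> [f [g [Ff hf ng ->]]] [f' [g' [Ff' hf' ng' ->]]].
exists (f + f'), (g + g'); split; last by rewrite addrACA.
- exact: span_add.
- move=> t; rewrite tcoeffD => nz.
  have [ft|/hf //] := eqVneq (tcoeff f t) 0.
  by apply: hf'; rewrite ft add0r in nz.
- exact: span_add.
Qed.

Lemma decomposesCZ s (c : A) v : decomposes s v -> decomposes s (c%:MP *: v).
Proof.
move=> [f [g [Ff hf ng ->]]]; exists (c%:MP *: f), (c%:MP *: g); split.
- exact: family_scale.
- move=> t; rewrite tcoeffCZ => nz; apply: hf; apply: contra_neq nz => ->.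
  by rewrite mulr0.
- move: ng; apply: span_scale (c) _ _ _ _; [exact: scalerDr|exact: scaler0|].
  by move=> a x; rewrite scalerA mpolyCM.
- by rewrite scalerDr.
Qed.

Lemma decomposes_sum s (I : eqType) (r : seq I) (v : I -> 'cV[RA]_m) :
  (forall i, i \in r -> decomposes s (v i)) -> decomposes s (\sum_(i <- r) v i).
Proof.
move=> h; rewrite big_seq; elim/big_ind: _ => //; first exact: decomposes0.
exact: decomposesD.
Qed.

(** A term of U in the cone of p_l is x^e F_l plus a combination of the terms
    x^e x^a with x^a in the tail of F_l.  Each of these is normal or has, by
    [cone_weight], a multiplier of smaller weight. *)
Lemma decomposes_tvec s (t : term n m) :
    pommaret_basis U (fun t => t \in P) -> marked_set d U F -> tdeg d t = s ->
  decomposes s (tvec A t).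
Proof.
move=> hP mF ts; have [_ hU _] := hP.
(* A base N exceeding every exponent that occurs in a term of degree s. *)
pose N := (\max_k `|s - d k|%N).+1.
have exponent_lt (a b : 'X_{1..n.+1}) k i :
    tdeg d ((a + b)%MM, k) = s -> (a i < N)%N.
  move=> abs; rewrite /N ltnS; apply: leq_trans (leq_bigmax k).
  by rewrite -abs /tdeg /= addrK absz_nat (leq_trans (mdeg_le _ _)) // mdegD leq_addr.
have normal_case u : tdeg d u = s -> normal_term U u -> decomposes s (tvec A u).
  move=> us nu; exists 0, (tvec A u); split; last by rewrite add0r.
  - by exists [::]; rewrite ?big_nil.
  - by move=> b; rewrite tcoeff0 eqxx.
  - exists [:: (1, tvec A u)]; last by rewrite big_seq1 scale1r.
    by move=> x; rewrite inE => /eqP -> /=; exists u.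
have [tU|] := EM (U (tvec K t)); last exact: normal_case.
move: tU => /hU [p pP [e emult tE]].
have [w] := ubnP (weight N e).
elim: w t e p pP ts emult tE => // w IH t e p pP ts emult tE ew.
have /tnthP [l pE] : p \in in_tuple P by [].
have eX : tvec A t = 'X_[e] *: F l + 'X_[e] *: (tvec A (pterm l) - F l).
  rewrite -scalerDr addrC subrK tE /tvec /= pE scalerA.
  by rewrite mpolyXD.
rewrite eX; apply: decomposesD.
  exists ('X_[e] *: F l), 0; split; last by rewrite addr0.
  - exact/family_scale/family_gen.
  - move=> b /tcoeff_scaleX_neq0 [b' /(marked_degree mF) b's ->].
    by rewrite -ts tE /tdeg /= !mdegD !PoszD -!addrA; congr (_ + _); rewrite pE; exact: b's.
  - by exists [::]; rewrite ?big_nil.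
rewrite [X in _ *: X]term_expand scaler_sumr; apply: decomposes_sum => k _.
rewrite scaler_sumr; apply: decomposes_sum => a.
rewrite mcoeff_msupp -/(tcoeff _ (a, k)) => ak.
rewrite scalerA mulrC -scalerA; apply: decomposesCZ.
rewrite /tvec /= scalerA -mpolyXD -/(tvec A ((e + a)%MM, k)).
have Fak : tcoeff (F l) (a, k) != 0 /\ (a, k) != pterm l.
  have [_ lead _] := mF l.
  move: ak; rewrite tcoeffB tcoeff_tvec.
  have [<-|ne] := eqVneq (pterm l) (a, k); first by rewrite lead subrr eqxx.
  by rewrite sub0r oppr_eq0.
have nak := marked_tail mF Fak.1 Fak.2.
have dak : tdeg d ((e + a)%MM, k) = s.
  rewrite -ts tE pE /tdeg /= !mdegD !PoszD -!addrA; congr (_ + _).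
  exact: marked_degree mF Fak.1.
have [tU|] := EM (U (tvec K ((e + a)%MM, k))); last exact: normal_case.
move: tU => /hU [p' p'P [e' e'mult tE']].
apply: (IH _ _ _ p'P dak e'mult tE').
rewrite -ltnS; apply: leq_trans ew; rewrite ltnS.
apply: (cone_weight hP p'P _ nak tE') => [|i]; first exact/coneDE.
by apply: (exponent_lt e' p'.1 k i); rewrite -dak tE' -(congr1 snd tE' : k = p'.2).
Qed.

Lemma decomposes_homogeneous s v :
    pommaret_basis U (fun t => t \in P) -> marked_set d U F ->
  homogeneous d s v -> decomposes s v.
Proof.
move=> hP mF hom; rewrite [v]term_expand.
apply: decomposes_sum => k _; apply: decomposes_sum => a.
rewrite mcoeff_msupp -/(tcoeff _ (a, k)) => ak.
by apply: decomposesCZ; apply: decomposes_tvec => //; apply: hom.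
Qed.

Lemma normal_span_support s (g : 'cV[RA]_m) t :
  normal_span d U s g -> tcoeff g t != 0 -> normal_term U t.
Proof.
case=> r rN ->; elim: r rN => [|x r IH] rN; first by rewrite big_nil tcoeff0 eqxx.
have rN' y : y \in r -> exists2 u, normal_term U u /\ tdeg d u = s & y.2 = tvec A u.
  by move=> yr; apply: rN; rewrite inE yr orbT.
rewrite big_cons tcoeffD; have [u [nu _] ->] := rN x (mem_head _ _).
rewrite tcoeffCZ tcoeff_tvec; have [<- //|_] := eqVneq u t.
by rewrite mulr0 add0r; apply: IH.
Qed.

Lemma marked_basis_of_lower_relations :
    uniq P -> pommaret_basis U (fun t => t \in P) -> marked_set d U F ->
    lower_relations F ->
  marked_basis d U F.
Proof.
move=> uniqP hP mF lower; split=> // s; split=> [v|v vF _ vN].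
  exact: decomposes_homogeneous.
have [q hq vE] := family_standard lower vF.
rewrite vE (standard_normal_eq0 uniqP hP mF hq).
  by apply: big1 => l _; rewrite mxE scale0r.
by move=> t; rewrite -vE; apply: normal_span_support vN.
Qed.

End Marked.

(** * The parametrized families *)

Section Parametrized.
Set Implicit Arguments.
Unset Strict Implicit.
Context (K : fieldType) {n m : nat} (d : 'I_m -> int).
Context (U : 'cV[{mpoly K[n.+1]}]_m -> Prop) (P : seq (term n m)).
Context (A : comAlgType K).
Notation RA := {mpoly A[n.+1]}.
Notation pterm j := (tnth (in_tuple P) j).
Context (C : 'I_(size P) -> term n m -> A).
Context (B : 'I_n.+1 -> 'I_(size P) -> term n (size P) -> A).
Notation F := (param_marked d U C).

Lemma param_marked_set :
  pommaret_basis U (fun t => t \in P) -> marked_set d U F.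
Proof.
move=> [_ hU _] j.
have tail t : tcoeff (F j - tvec A (pterm j)) t != 0 ->
    normal_term U t /\ tdeg d t = tdeg d (pterm j).
  rewrite addrAC subrr add0r -[- _]add0r tcoeffB tcoeff0 add0r oppr_eq0.
  rewrite tcoeff_sum big_seq_cond.
  elim/big_ind: _ => [|x y hx hy|u /andP [us /asboolP nu]].
  - by rewrite eqxx.
  - by have [->|/hx //] := eqVneq x 0; rewrite add0r.
  rewrite mem_terms_of_deg in us; rewrite tcoeffCZ tcoeff_tvec.
  have [<-|_] := eqVneq u t; last by rewrite mulr0 eqxx.
  by move=> _; split => //; apply/eqP.
split; last by move=> t /tail [].
- exists (tdeg d (pterm j)) => t; have [<- //|ne nz] := eqVneq (pterm j) t.
  by apply: (tail t _).2; rewrite tcoeffB tcoeff_tvec (negbTE ne) subr0.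
- have nU : ~ normal_term U (pterm j).
    apply; apply/hU; exists (pterm j); first exact: mem_tnth.
    exists 0%MM => [i _|]; first exact: mnm0E.
    by rewrite mpoly.add0m -surjective_pairing.
  apply/eqP; rewrite -subr_eq0; apply: contra_notT nU => nz.
  by apply: (tail _ _).1; rewrite tcoeffB tcoeff_tvec eqxx.
Qed.

Definition presyz_cofactors (i : 'I_n.+1) (j : 'I_(size P)) : 'cV[RA]_(size P) :=
  \sum_(t <- presyz_terms K d i j) (B i j t)%:MP *: tvec A t.

Lemma presyz_cofactors_support i j l eta :
    eta \in msupp (presyz_cofactors i j l 0) ->
  (maxvar eta <= minn i.-1 (minvar (pterm l).1))%N.
Proof.
rewrite mcoeff_msupp -/(tcoeff _ (eta, l)) /presyz_cofactors tcoeff_sum big_seq.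
elim/big_ind: _ => [|x y hx hy|u].
- by rewrite eqxx.
- by have [->|/hx //] := eqVneq x 0; rewrite add0r.
rewrite tcoeffCZ tcoeff_tvec mem_filter => /andP [/andP [_ le] _].
by have [uE|_] := eqVneq u (eta, l); [move: le; rewrite uE | rewrite mulr0 eqxx].
Qed.

(** A pre-syzygy, read as a vector of coefficients, applied to any family G: the
    columns of M_1 become relations. *)
Lemma presyz_apply i j (G : 'I_(size P) -> 'cV[RA]_m) :
  \sum_l presyz d B i j l 0 *: G l
    = 'X_i *: G j - \sum_l presyz_cofactors i j l 0 *: G l.
Proof.
have -> : 'X_i *: G j = \sum_l ('X_i *: delta_mx j 0 : 'cV[RA]_(size P)) l 0 *: G l.
  rewrite (bigD1 j) //= !mxE !eqxx mulr1 big1 ?addr0 // => l /negbTE lj.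
  by rewrite !mxE lj mulr0 scale0r.
rewrite -sumrB; apply: eq_bigr => l _.
by rewrite -scalerBl /presyz !mxE.
Qed.

Lemma M0M1_eq0 :
  M0 d U C *m M1 d B = 0 <->
  forall i j, nonmult (pterm j).1 i ->
    'X_i *: F j = \sum_l presyz_cofactors i j l 0 *: F l.
Proof.
have entry k c : (M0 d U C *m M1 d B) k c =
    (\sum_l presyz d B (tnth (in_tuple (nonmult_pairs P)) c).1
      (tnth (in_tuple (nonmult_pairs P)) c).2 l 0 *: F l) k 0.
  rewrite !mxE summxE; apply: eq_bigr => l _.
  by rewrite !mxE mulrC.
split=> [M0 i j nm|rel].
  have /tnthP [c cE] : (i, j) \in in_tuple (nonmult_pairs P).
    by rewrite mem_filter nm mem_enum.
  apply/eqP; rewrite -subr_eq0 -presyz_apply; apply/eqP/colP => k.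
  by have := entry k c; rewrite M0 -cE /= => <-; rewrite !mxE.
apply/matrixP => k c; rewrite entry.
have := mem_tnth c (in_tuple (nonmult_pairs P)).
rewrite mem_filter => /andP [nm _].
by rewrite presyz_apply rel // subrr !mxE.
Qed.

Lemma leq_maxvar (a : 'X_{1..n.+1}) (k : 'I_n.+1) : a k != 0%N -> (k <= maxvar a)%N.
Proof. exact: (@leq_bigmax_cond _ (fun k => a k != 0%N) (fun k => k : nat) k). Qed.

End Parametrized.

Theorem corollary4p11 (K : fieldType) (n m : nat) (d : 'I_m -> int)
    (U : 'cV[{mpoly K[n.+1]}]_m -> Prop)
    (P : seq (term n m))
    (A : comAlgType K)
    (C : 'I_(size P) -> term n m -> A)
    (B : 'I_n.+1 -> 'I_(size P) -> term n (size P) -> A)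
    (hU : quasi_stable U)
    (uniqP : uniq P)
    (hP : pommaret_basis U (fun t => t \in P))
    (hA : noetherian A) :
  (marked_basis d U (param_marked d U C) /\
   forall (i : 'I_n.+1) (j : 'I_(size P)),
     nonmult (tnth (in_tuple P) j).1 i ->
     fundamental_syzygy (param_marked d U C) i j (presyz d B i j))
  <-> M0 d U C *m M1 d B = 0.
Proof.
split=> [[_ syz]|/M0M1_eq0 rel].
  apply/M0M1_eq0 => i j /(syz i j) [q [_ rel /addrI/oppr_inj qE]].
  by rewrite rel -qE.
split; last first.
  move=> i j nm; exists (presyz_cofactors d B i j); split => //; last exact: rel.
  move=> l eta /presyz_cofactors_support le; apply/coneDE => k nk.
  apply/eqP; apply: contraTT nk => /leq_maxvar ke; rewrite /nonmult -leqNgt.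
  by rewrite (leq_trans ke) // (leq_trans le) // geq_minr.
apply: marked_basis_of_lower_relations => //; first exact: param_marked_set.
move=> i j nm; exists (presyz_cofactors d B i j); first exact: rel.
move=> l eta /presyz_cofactors_support le k /leq_maxvar ke.
(* The bound on the variables uses i.-1, which is below i only for i > 0. *)
have i_gt0 : (0 < i)%N by apply: leq_trans nm.
rewrite -(prednK i_gt0) ltnS (leq_trans ke) // (leq_trans le) //.
exact: geq_minl.
Qed.
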